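(* Let $A$ be a unital C*-algebra such that every maximal abelian self-adjoint subalgebra of $A$ is monotone $\sigma$-complete. Then $A$ is a Rickart C*-algebra; more precisely, for each $x\in A$ there is a projection $f\in A$ with $\{z\in A: xz=0\}=fA$.
   Context: A C*-algebra $B$ is monotone $\sigma$-complete if every norm-bounded monotone increasing sequence in $B_{sa}$ has a supremum in $B_{sa}$ (for a maximal abelian self-adjoint subalgebra $M$, suprema are taken in $M_{sa}$). A C*-algebra $B$ is Rickart if for each $a\in B$ there is a projection $p\in B$ such that $\{z\in B: az=0\}=pB$. *)

(* Defs.v *)
From Stdlib Require Import Reals.
Open Scope R_scope.

Definition Cplx : Type := (R * R)%type.
Definition Cre (z : Cplx) : R := fst z.
Definition Cim (z : Cplx) : R := snd z.
Definition Cof (r : R) : Cplx := (r, 0).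
Definition C0 : Cplx := (0, 0).
Definition C1 : Cplx := (1, 0).
Definition Cadd (z w : Cplx) : Cplx := (Cre z + Cre w, Cim z + Cim w).
Definition Cmul (z w : Cplx) : Cplx :=
  (Cre z * Cre w - Cim z * Cim w, Cre z * Cim w + Cim z * Cre w).
Definition Cconj (z : Cplx) : Cplx := (Cre z, - Cim z).
Definition Cmod (z : Cplx) : R := sqrt (Cre z * Cre z + Cim z * Cim z).

Record UnitalCStarAlgebra : Type := {
  carrier :> Type;
  zero : carrier;
  one : carrier;
  add : carrier -> carrier -> carrier;
  opp : carrier -> carrier;
  mul : carrier -> carrier -> carrier;
  smul : Cplx -> carrier -> carrier;
  star : carrier -> carrier;
  norm : carrier -> R;
  add_assoc : forall a b c, add a (add b c) = add (add a b) c;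
  add_comm : forall a b, add a b = add b a;
  add_zero : forall a, add a zero = a;
  add_opp : forall a, add a (opp a) = zero;
  smul_assoc : forall (l m : Cplx) a, smul l (smul m a) = smul (Cmul l m) a;
  smul_one : forall a, smul C1 a = a;
  smul_addr : forall l a b, smul l (add a b) = add (smul l a) (smul l b);
  smul_addl : forall l m a, smul (Cadd l m) a = add (smul l a) (smul m a);
  mul_assoc : forall a b c, mul a (mul b c) = mul (mul a b) c;
  mul_addr : forall a b c, mul a (add b c) = add (mul a b) (mul a c);
  mul_addl : forall a b c, mul (add a b) c = add (mul a c) (mul b c);
  mul_one_l : forall a, mul one a = a;
  mul_one_r : forall a, mul a one = a;
  smul_mull : forall l a b, smul l (mul a b) = mul (smul l a) b;
  smul_mulr : forall l a b, smul l (mul a b) = mul a (smul l b);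
  star_add : forall a b, star (add a b) = add (star a) (star b);
  star_smul : forall l a, star (smul l a) = smul (Cconj l) (star a);
  star_mul : forall a b, star (mul a b) = mul (star b) (star a);
  star_star : forall a, star (star a) = a;
  norm_nonneg : forall a, 0 <= norm a;
  norm_eq0 : forall a, norm a = 0 -> a = zero;
  norm_smul : forall l a, norm (smul l a) = Cmod l * norm a;
  norm_triangle : forall a b, norm (add a b) <= norm a + norm b;
  norm_submult : forall a b, norm (mul a b) <= norm a * norm b;
  complete : forall u : nat -> carrier,
    (forall eps, 0 < eps -> exists N, forall n m, (N <= n)%nat -> (N <= m)%nat ->
        norm (add (u n) (opp (u m))) < eps) ->
    exists l, forall eps, 0 < eps -> exists N, forall n, (N <= n)%nat ->
        norm (add (u n) (opp l)) < eps;
  cstar_identity : forall a, norm (mul (star a) a) = norm a * norm a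
}.

Section CStarNotions.
Variable A : UnitalCStarAlgebra.

Definition sub (a b : A) : A := add A a (opp A b).

Definition self_adjoint (a : A) : Prop := star A a = a.

Definition is_projection (p : A) : Prop := star A p = p /\ mul A p p = p.

Definition invertible (a : A) : Prop :=
  exists b : A, mul A a b = one A /\ mul A b a = one A.

Definition in_spectrum (a : A) (l : Cplx) : Prop :=
  ~ invertible (sub a (smul A l (one A))).

Definition positive (a : A) : Prop :=
  self_adjoint a /\
  forall l : Cplx, in_spectrum a l -> Cim l = 0 /\ 0 <= Cre l.

Definition cle (a b : A) : Prop := positive (sub b a).

Definition self_adjoint_subalgebra (M : A -> Prop) : Prop :=
  M (zero A) /\
  (forall a b, M a -> M b -> M (add A a b)) /\
  (forall l a, M a -> M (smul A l a)) /\
  (forall a b, M a -> M b -> M (mul A a b)) /\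
  (forall a, M a -> M (star A a)).

Definition abelian (M : A -> Prop) : Prop :=
  forall a b, M a -> M b -> mul A a b = mul A b a.

Definition abelian_sa_subalgebra (M : A -> Prop) : Prop :=
  self_adjoint_subalgebra M /\ abelian M.

Definition masa (M : A -> Prop) : Prop :=
  abelian_sa_subalgebra M /\
  forall N : A -> Prop, abelian_sa_subalgebra N ->
    (forall a, M a -> N a) -> forall a, N a -> M a.

Definition monotone_sigma_complete_sub (M : A -> Prop) : Prop :=
  forall u : nat -> A,
    (forall n, M (u n) /\ self_adjoint (u n)) ->
    (forall n, cle (u n) (u (S n))) ->
    (exists K : R, forall n, norm A (u n) <= K) ->
    exists s : A, M s /\ self_adjoint s /\
      (forall n, cle (u n) s) /\
      (forall t : A, M t -> self_adjoint t -> (forall n, cle (u n) t) -> cle s t).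

Definition right_annihilator_is_projection_ideal (x : A) : Prop :=
  exists f : A, is_projection f /\
    forall z : A, mul A x z = zero A <-> exists y : A, z = mul A f y.

Definition rickart : Prop := forall x : A, right_annihilator_is_projection_ideal x.

End CStarNotions.

(* Main.v *)
(* Put h = x* x, so that xz = 0 iff hz = 0. Let D be a maximal commuting set of
   self-adjoint elements annihilated by h, and let M be a masa containing D and
   h. Inside M, the supremum s of the increasing sequence 1 - (1 - a)^n, where a
   is a multiple of h^2 with 0 <= a <= 1, gives a projection p = 1 - s with
   hp = 0 and pd = d for every d in M with hd = 0. By maximality p lies in D and
   is a unit for D. If now hz = 0 and g = (1 - p)z, then gg* is annihilated by h
   and by D, so it lies in D, and gg* = p gg* = 0; that is, z = pz.

   The supremum is taken for the order defined by the spectrum. On commuting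
   self-adjoint elements, b >= 0 iff b is a square: square roots of 1 - h for
   |h| <= 1 come from an iteration, and instead of the Gelfand transform one uses
   |x|^2 <= |x^2 + y^2|, which is the C*-identity for x + iy. *)

From Stdlib Require Import Reals Lra Lia Classical ProofIrrelevance Ring.
From mathcomp.classical Require classical_sets.
Require Import Defs.

(** * Real commutative Banach algebras of continuous functions *)

(* By Arens' theorem these are the algebras C(X, R); [rsc r] is the constant r. *)
Record RealFunctionAlgebra : Type := {
  rcar :> Type;
  r0 : rcar;
  r1 : rcar;
  radd : rcar -> rcar -> rcar;
  rmul : rcar -> rcar -> rcar;
  ropp : rcar -> rcar;
  rsc : R -> rcar;
  rnorm : rcar -> R;
  rring : ring_theory r0 r1 radd rmul (fun x y => radd x (ropp y)) ropp eq;
  rsc_1 : rsc 1 = r1;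
  rsc_add : forall s t, rsc (s + t) = radd (rsc s) (rsc t);
  rsc_mul : forall s t, rsc (s * t) = rmul (rsc s) (rsc t);
  rnorm_nonneg : forall x, 0 <= rnorm x;
  rnorm_eq0 : forall x, rnorm x = 0 -> x = r0;
  rnorm_add : forall x y, rnorm (radd x y) <= rnorm x + rnorm y;
  rnorm_mul : forall x y, rnorm (rmul x y) <= rnorm x * rnorm y;
  rnorm_scale : forall s x, rnorm (rmul (rsc s) x) = Rabs s * rnorm x;
  rnorm_sqr : forall x, rnorm (rmul x x) = rnorm x * rnorm x;
  rnorm_sum_sqr : forall x y,
    rnorm x * rnorm x <= rnorm (radd (rmul x x) (rmul y y));
  rcomplete : forall u : nat -> rcar,
    (forall eps, 0 < eps -> exists N, forall n m, (N <= n)%nat -> (N <= m)%nat ->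
        rnorm (radd (u n) (ropp (u m))) < eps) ->
    exists l, forall eps, 0 < eps -> exists N, forall n, (N <= n)%nat ->
        rnorm (radd (u n) (ropp l)) < eps
}.

Section RealFunctionAlgebraTheory.
Variable B : RealFunctionAlgebra.
Implicit Types a b c d h p x y : B.

Declare Scope fun_scope.
Delimit Scope fun_scope with fn.
Local Notation "0" := (r0 B) : fun_scope.
Local Notation "1" := (r1 B) : fun_scope.
Local Notation "x + y" := (radd B x%fn y%fn) : fun_scope.
Local Notation "x * y" := (rmul B x%fn y%fn) : fun_scope.
Local Notation "- x" := (ropp B x%fn) : fun_scope.
Local Notation "x - y" := (radd B x%fn (ropp B y%fn)) : fun_scope.
Local Notation "# r" := (rsc B r%R) (at level 2, r at level 2) : fun_scope.
Local Notation "⟦ x ⟧" := (rnorm B x%fn) (x at level 99).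

Add Ring fun_ring : (rring B).

Fixpoint rpow x (n : nat) : B :=
  match n with O => 1%fn | S n => (x * rpow x n)%fn end.

Definition is_square b : Prop := exists c, b = (c * c)%fn.

(** * Constants and elementary norm estimates *)

Lemma rsc_0 : (#0 = 0)%fn.
Proof.
  assert (H := rsc_add B 0 0). rewrite Rplus_0_r in H.
  transitivity (#0 + #0 - #0)%fn; [ring | rewrite <- H; ring].
Qed.

Lemma rsc_opp s : (#(- s) = - #s)%fn.
Proof.
  assert (H := rsc_add B s (- s)). rewrite Rplus_opp_r, rsc_0 in H.
  transitivity (#s + #(- s) - #s)%fn; [ring | rewrite <- H; ring].
Qed.

Lemma rsc_inv_mul s x : s <> 0 -> (#s * (#(/ s) * x) = x)%fn.
Proof.
  intros Hs. transitivity ((#s * #(/ s)) * x)%fn; [ring|].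
  rewrite <- rsc_mul, Rinv_r, rsc_1 by exact Hs. ring.
Qed.

Lemma rnorm_0 : ⟦0⟧ = 0.
Proof.
  replace 0%fn with (#0 * 0)%fn by ring.
  rewrite rnorm_scale, Rabs_R0. ring.
Qed.

Lemma rnorm_opp x : ⟦- x⟧ = ⟦x⟧.
Proof.
  replace (- x)%fn with (#(- (1)) * x)%fn by (rewrite rsc_opp, rsc_1; ring).
  rewrite rnorm_scale, Rabs_Ropp, Rabs_R1. ring.
Qed.

(** The norm of 1 equals its own square. Only an inequality holds, since in the zero algebra this
    norm is 0. *)
Lemma rnorm_1_le : ⟦1⟧ <= 1.
Proof.
  assert (H := rnorm_sqr B 1%fn). replace (1 * 1)%fn with 1%fn in H by ring.
  assert (H0 := rnorm_nonneg B 1%fn). nra.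
Qed.

Lemma rnorm_sc_le s : ⟦#s⟧ <= Rabs s.
Proof.
  replace (#s)%fn with (#s * 1)%fn by ring. rewrite rnorm_scale.
  assert (H := rnorm_1_le). assert (H1 := Rabs_pos s). nra.
Qed.

Lemma rnorm_sub_sym x y : ⟦x - y⟧ = ⟦y - x⟧.
Proof. rewrite <- rnorm_opp. f_equal. ring. Qed.

Lemma rnorm_small x : (forall eps, 0 < eps -> ⟦x⟧ <= eps) -> x = 0%fn.
Proof.
  intros H. apply rnorm_eq0. apply Rle_antisym; [|apply rnorm_nonneg].
  destruct (Rle_or_lt (⟦x⟧) 0) as [Hx|Hx]; [exact Hx|].
  specialize (H (⟦x⟧ / 2)). lra.
Qed.

Lemma rmul_self_eq0 x : (x * x = 0)%fn -> x = 0%fn.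
Proof.
  intros H. apply rnorm_eq0. assert (H1 := rnorm_sqr B x).
  rewrite H, rnorm_0 in H1. nra.
Qed.

(** * Fixed points of majorized iterations *)

(** The bounds on increments make [r] increasing; being bounded, it is Cauchy, and telescoping
    carries this over to [u]. *)
Lemma majorized_converges (u : nat -> B) (r : nat -> R) K :
  (forall n, ⟦u (S n) - u n⟧ <= r (S n) - r n) -> (forall n, r n <= K) ->
  exists l, forall eps, 0 < eps -> exists N, forall n, (N <= n)%nat -> ⟦u n - l⟧ < eps.
Proof.
  intros Hu HK.
  assert (Hd : forall n k, ⟦u (n + k)%nat - u n⟧ <= r (n + k)%nat - r n).
  { intros n k; induction k as [|k IH].
    - rewrite Nat.add_0_r. replace (u n - u n)%fn with 0%fn by ring.
      rewrite rnorm_0. lra.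
    - rewrite Nat.add_succ_r.
      replace (u (S (n + k)) - u n)%fn
        with ((u (S (n + k)) - u (n + k)%nat) + (u (n + k)%nat - u n))%fn by ring.
      eapply Rle_trans; [apply rnorm_add|]. specialize (Hu (n + k)%nat). lra. }
  assert (Hgrow : Un_growing r).
  { intros n. assert (H := rnorm_nonneg B (u (S n) - u n)%fn). specialize (Hu n). lra. }
  assert (Hbound : bound (EUn r)).
  { exists K. intros x [n ->]. apply HK. }
  destruct (Un_cv_crit r Hgrow Hbound) as [l Hl].
  assert (HC := CV_Cauchy r (exist _ l Hl)).
  apply rcomplete. intros eps Heps. destruct (HC eps Heps) as [N HN].
  exists N. intros n m Hn Hm.
  destruct (Nat.le_ge_cases m n) as [H|H].
  - replace n with (m + (n - m))%nat at 1 by lia.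
    eapply Rle_lt_trans; [apply Hd|]. replace (m + (n - m))%nat with n by lia.
    specialize (HN n m Hn Hm). unfold Rdist in HN. apply Rabs_def2 in HN. lra.
  - rewrite rnorm_sub_sym. replace m with (n + (m - n))%nat at 1 by lia.
    eapply Rle_lt_trans; [apply Hd|]. replace (n + (m - n))%nat with m by lia.
    specialize (HN n m Hn Hm). unfold Rdist in HN. apply Rabs_def2 in HN. lra.
Qed.

(** The limit of the iteration is fixed because [F] is continuous there. The Lipschitz factor may
    grow with the norms, so that one lemma serves both a quadratic map (square roots) and an affine
    one (inverses). *)
Lemma majorized_fixpoint (F : B -> B) (u : nat -> B) (r : nat -> R) K :
  (forall x y, ⟦F x - F y⟧ <= (1 + ⟦x⟧ + ⟦y⟧) * ⟦x - y⟧) ->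
  (forall n, u (S n) = F (u n)) ->
  (forall n, ⟦u (S n) - u n⟧ <= r (S n) - r n) -> (forall n, r n <= K) ->
  exists l, l = F l.
Proof.
  intros HF Hu Hr HK.
  destruct (majorized_converges u r K Hr HK) as [l Hl]. exists l.
  assert (H0 : (l - F l)%fn = 0%fn).
  { apply rnorm_small. intros eps Heps.
    assert (Hnl := rnorm_nonneg B l).
    (* Once [u N] is within 1 of [l], the Lipschitz factor is at most [2 + 2 * ⟦l⟧], that is
       [C - 1]; the remaining 1 pays for the distance from [u (S N)] to [l]. *)
    set (C := 3 + 2 * ⟦l⟧).
    assert (HC : 0 < C) by (unfold C; lra).
    destruct (Hl (Rmin 1 (eps / C))) as [N HN].
    { apply Rmin_pos; [lra|]. apply Rdiv_lt_0_compat; assumption. }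
    assert (H1 := HN N (le_n N)). assert (H2 := HN (S N) (le_S _ _ (le_n N))).
    assert (Hm1 := Rmin_l 1 (eps / C)). assert (Hm2 := Rmin_r 1 (eps / C)).
    assert (Hq : eps / C * C = eps) by (field; lra).
    set (delta := eps / C) in *. clearbody delta.
    assert (HuN : ⟦u N⟧ <= ⟦u N - l⟧ + ⟦l⟧).
    { replace (u N) with ((u N - l) + l)%fn at 1 by ring. apply rnorm_add. }
    replace (l - F l)%fn with ((l - u (S N)) + (F (u N) - F l))%fn
      by (rewrite Hu; ring).
    eapply Rle_trans; [apply rnorm_add|].
    assert (H3 := HF (u N) l). rewrite (rnorm_sub_sym l).
    assert (H4 := rnorm_nonneg B (u N - l)%fn).
    assert (H5 : (1 + ⟦u N⟧ + ⟦l⟧) * ⟦u N - l⟧ <= (C - 1) * ⟦u N - l⟧)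
      by (apply Rmult_le_compat_r; unfold C; lra).
    assert (H6 : (C - 1) * ⟦u N - l⟧ <= (C - 1) * delta)
      by (apply Rmult_le_compat_l; unfold C; lra).
    lra. }
  transitivity ((l - F l) + F l)%fn; [ring | rewrite H0; ring].
Qed.

(* A fixed point [l = (h + l^2)/2] gives [1 - h = (1 - l)^2]; the iteration
   towards it is majorized by the same iteration for the number 1, which stays
   below 1. *)
Lemma one_minus_is_square h : ⟦h⟧ <= 1 -> is_square (1 - h)%fn.
Proof.
  intros Hh.
  set (F := fun x : B => (#(/ 2) * (h + x * x))%fn).
  set (u := nat_rect (fun _ => rcar B) 0%fn (fun _ => F)).
  set (r := nat_rect (fun _ => R) 0 (fun _ s => (1 + s * s) / 2)).
  assert (Hhalf : Rabs (/ 2) = / 2) by (apply Rabs_right; lra).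
  assert (Hr : forall n, 0 <= r n <= 1).
  { induction n as [|n IH]; simpl; [lra|]. fold (r n). nra. }
  assert (Hur : forall n, ⟦u n⟧ <= r n).
  { induction n as [|n IH]; simpl; [rewrite rnorm_0; lra|].
    change (⟦F (u n)⟧ <= (1 + r n * r n) / 2). unfold F.
    rewrite rnorm_scale, Hhalf.
    assert (H1 := rnorm_add B h (u n * u n)%fn). rewrite rnorm_sqr in H1.
    assert (H2 := rnorm_nonneg B (u n)). nra. }
  assert (HFd : forall x y, ⟦F x - F y⟧ <= / 2 * ((⟦x⟧ + ⟦y⟧) * ⟦x - y⟧)).
  { intros x y.
    replace (F x - F y)%fn with (#(/ 2) * ((x + y) * (x - y)))%fn by (unfold F; ring).
    rewrite rnorm_scale, Hhalf. apply Rmult_le_compat_l; [lra|].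
    eapply Rle_trans; [apply rnorm_mul|].
    apply Rmult_le_compat_r; [apply rnorm_nonneg | apply rnorm_add]. }
  destruct (majorized_fixpoint F u r 1) as [l Hl].
  - intros x y. eapply Rle_trans; [apply HFd|].
    assert (H1 := rnorm_nonneg B x). assert (H2 := rnorm_nonneg B y).
    assert (H3 := rnorm_nonneg B (x - y)%fn). nra.
  - reflexivity.
  - induction n as [|n IH].
    + simpl. replace (F 0 - 0)%fn with (#(/ 2) * h)%fn by (unfold F; ring).
      rewrite rnorm_scale, Hhalf. lra.
    + change (⟦F (u (S n)) - F (u n)⟧
              <= (1 + r (S n) * r (S n)) / 2 - (1 + r n * r n) / 2).
      eapply Rle_trans; [apply HFd|].
      assert (H1 := Hur n). assert (H2 := Hur (S n)).
      assert (H3 := rnorm_nonneg B (u (S n) - u n)%fn).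
      assert (H4 := rnorm_nonneg B (u n)). assert (H5 := rnorm_nonneg B (u (S n))).
      assert (H6 : (⟦u (S n)⟧ + ⟦u n⟧) * ⟦u (S n) - u n⟧
                   <= (r (S n) + r n) * (r (S n) - r n))
        by (apply Rmult_le_compat; lra).
      lra.
  - apply Hr.
  - exists (1 - l)%fn.
    assert (H : (l + l = h + l * l)%fn).
    { rewrite Hl at 1 2. unfold F.
      transitivity ((#(/ 2) + #(/ 2)) * (h + l * l))%fn; [ring|].
      rewrite <- rsc_add. replace (/ 2 + / 2) with 1 by lra. rewrite rsc_1. ring. }
    transitivity (1 - (l + l) + l * l)%fn; [rewrite H; ring | ring].
Qed.

(** The Neumann series, obtained as the fixed point of [x -> 1 + h x] and majorized by the partial
    sums of the geometric series of ratio [⟦h⟧]. *)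
Lemma one_minus_invertible h : ⟦h⟧ < 1 -> exists w, ((1 - h) * w = 1)%fn.
Proof.
  intros Hh. set (q := ⟦h⟧) in *. assert (Hq := rnorm_nonneg B h). fold q in Hq.
  set (F := fun x : B => (1 + h * x)%fn).
  set (u := nat_rect (fun _ => rcar B) 0%fn (fun _ => F)).
  set (r := fun n => (1 - q ^ n) / (1 - q)).
  assert (Hrd : forall n, r (S n) - r n = q ^ n).
  { intros n. unfold r. simpl. field. lra. }
  assert (HFd : forall x y, ⟦F x - F y⟧ <= q * ⟦x - y⟧).
  { intros x y. replace (F x - F y)%fn with (h * (x - y))%fn by (unfold F; ring).
    apply rnorm_mul. }
  destruct (majorized_fixpoint F u r (1 / (1 - q))) as [l Hl].
  - intros x y. eapply Rle_trans; [apply HFd|].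
    assert (H1 := rnorm_nonneg B x). assert (H2 := rnorm_nonneg B y).
    assert (H3 := rnorm_nonneg B (x - y)%fn). nra.
  - reflexivity.
  - intros n. rewrite Hrd. induction n as [|n IH].
    + simpl. replace (F 0 - 0)%fn with 1%fn by (unfold F; ring). apply rnorm_1_le.
    + change (⟦F (u (S n)) - F (u n)⟧ <= q * q ^ n).
      eapply Rle_trans; [apply HFd|]. apply Rmult_le_compat_l; assumption.
  - intros n. unfold r. apply Rmult_le_compat_r.
    + left. apply Rinv_0_lt_compat. lra.
    + assert (H := pow_le q n Hq). lra.
  - exists l. transitivity (l - h * l)%fn; [ring|]. rewrite Hl at 1. unfold F. ring.
Qed.

(** * The cone of squares *)

Lemma is_square_mul b c : is_square b -> is_square c -> is_square (b * c)%fn.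
Proof. intros [x ->] [y ->]. exists (x * y)%fn. ring. Qed.

Lemma is_square_sc s : 0 <= s -> is_square (#s)%fn.
Proof.
  intros Hs. exists (#(sqrt s))%fn. rewrite <- rsc_mul, sqrt_sqrt by exact Hs. reflexivity.
Qed.

Lemma is_square_1 : is_square 1%fn.
Proof. exists 1%fn. ring. Qed.

Lemma is_square_pow b n : is_square b -> is_square (rpow b n).
Proof.
  intros Hb. induction n as [|n IH]; [exact is_square_1|].
  apply is_square_mul; assumption.
Qed.

Lemma sc_minus_is_square b t : ⟦b⟧ <= t -> is_square (#t - b)%fn.
Proof.
  intros Hb. assert (H0 := rnorm_nonneg B b).
  destruct (Req_dec t 0) as [Ht|Ht].
  - assert (Hb0 : b = 0%fn) by (apply rnorm_eq0; lra).
    exists 0%fn. rewrite Ht, Hb0, rsc_0. ring.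
  - replace (#t - b)%fn with (#t * (1 - #(/ t) * b))%fn.
    2:{ transitivity (#t - #t * (#(/ t) * b))%fn; [ring|].
        rewrite rsc_inv_mul by exact Ht. ring. }
    apply is_square_mul; [apply is_square_sc; lra|]. apply one_minus_is_square.
    rewrite rnorm_scale, Rabs_inv, Rabs_right by lra.
    apply (Rmult_le_reg_l t); [lra|]. field_simplify; lra.
Qed.

(** Monotonicity of the norm on the cone, which is what [rnorm_sum_sqr] is for. *)
Lemma rnorm_le_add b c : is_square b -> is_square c -> ⟦b⟧ <= ⟦b + c⟧.
Proof. intros [x ->] [y ->]. rewrite rnorm_sqr. apply rnorm_sum_sqr. Qed.

Lemma rnorm_sc_minus_le b t : is_square b -> ⟦b⟧ <= t -> ⟦#t - b⟧ <= t.
Proof.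
  intros Hb Ht. assert (H0 := rnorm_nonneg B b).
  eapply Rle_trans; [apply (rnorm_le_add _ b); [apply sc_minus_is_square|]; assumption|].
  replace (#t - b + b)%fn with (#t)%fn by ring.
  eapply Rle_trans; [apply rnorm_sc_le|]. rewrite Rabs_right; lra.
Qed.

(** With [s = ⟦b⟧] and [t = ⟦c⟧], the elements [s - b] and [t - c] have norms at most [s] and [t],
    so [b + c] is [s + t] minus an element of norm at most [s + t]. *)
Lemma is_square_add b c : is_square b -> is_square c -> is_square (b + c)%fn.
Proof.
  intros Hb Hc.
  replace (b + c)%fn
    with (#(⟦b⟧ + ⟦c⟧) - ((#(⟦b⟧) - b) + (#(⟦c⟧) - c)))%fn
    by (rewrite rsc_add; ring).
  apply sc_minus_is_square. eapply Rle_trans; [apply rnorm_add|].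
  apply Rplus_le_compat; apply rnorm_sc_minus_le; auto using Rle_refl.
Qed.

(** With [t = ⟦b⟧], write [b + eps = (t + eps) (1 - (t - b) / (t + eps))]; the subtracted quotient
    has norm at most [t / (t + eps) < 1]. *)
Lemma is_square_add_sc_invertible b eps :
  is_square b -> 0 < eps -> exists y, ((b + #eps) * y = 1)%fn.
Proof.
  intros Hb Heps. set (t := ⟦b⟧). assert (Ht : 0 <= t) by apply rnorm_nonneg.
  assert (Hte : t + eps <> 0) by lra.
  destruct (one_minus_invertible (#(/ (t + eps)) * (#t - b))%fn) as [w Hw].
  - rewrite rnorm_scale, Rabs_inv, Rabs_right by lra.
    assert (H := rnorm_sc_minus_le b t Hb (Rle_refl _)).
    apply (Rmult_lt_reg_l (t + eps)); [lra|]. rewrite <- Rmult_assoc, Rinv_r by exact Hte.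
    lra.
  - exists (#(/ (t + eps)) * w)%fn. rewrite <- Hw.
    transitivity ((#(t + eps) * (#(/ (t + eps)) * 1)
                   - #(/ (t + eps)) * (#t - b)) * w)%fn;
      [rewrite rsc_add; ring | rewrite rsc_inv_mul by exact Hte; ring].
Qed.

(* With [t = ⟦b⟧], the element [e = t - b] is a square; if [m = ⟦e⟧ > t] then
   [m - e = d^2] is invertible, so bounded below by [1/K], which forces
   [⟦e⟧ <= m - 1/K]. Hence [⟦t - b⟧ <= t] and [b = t - (t - b)] is a square. *)
Lemma add_sc_invertible_is_square b :
  (forall eps, 0 < eps -> exists y, ((b + #eps) * y = 1)%fn) -> is_square b.
Proof.
  intros Hinv. set (t := ⟦b⟧). set (e := (#t - b)%fn).
  replace b with (#t - e)%fn by (unfold e; ring).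
  apply sc_minus_is_square.
  assert (Ht : 0 <= t) by apply rnorm_nonneg.
  destruct (Rle_or_lt (⟦e⟧) t) as [H|Hm]; [exact H|exfalso].
  set (m := ⟦e⟧) in *.
  assert (He : is_square e) by (apply sc_minus_is_square, Rle_refl).
  destruct (sc_minus_is_square e m (Rle_refl _)) as [d Hd].
  destruct (Hinv (m - t)) as [y Hy]; [lra|].
  replace (b + #(m - t))%fn with (d * d)%fn in Hy.
  2:{ rewrite <- Hd. unfold Rminus, e. rewrite rsc_add, rsc_opp. ring. }
  (* The summand [⟦y⟧] makes [K - y] a square [g^2]; the summand [/ m] makes [K m - 1]
     nonnegative. *)
  set (K := ⟦y⟧ + / m).
  assert (Hy0 := rnorm_nonneg B y).
  assert (Hm0 : 0 < / m) by (apply Rinv_0_lt_compat; lra).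
  assert (HKm : K * m = ⟦y⟧ * m + 1) by (unfold K; field; lra).
  destruct (sc_minus_is_square y K) as [g Hg]; [unfold K; lra|].
  (* Multiply [K - y = g^2] by [d^2 = m - e] and use [d^2 y = 1]. Taking norms then gives the absurd
     [K m <= K m - 1]. *)
  assert (Heq : (#(K * m - 1) = #K * e + (g * d) * (g * d))%fn).
  { transitivity (#K * e + (g * g) * (d * d))%fn; [|ring].
    rewrite <- Hg. unfold Rminus. rewrite rsc_add, rsc_mul, rsc_opp, rsc_1.
    transitivity (#K * e + #K * (d * d) - (d * d) * y)%fn; [|ring].
    rewrite Hy, <- Hd. ring. }
  assert (Hle : ⟦#K * e⟧ <= ⟦#(K * m - 1)⟧).
  { rewrite Heq. apply rnorm_le_add; [|exists (g * d)%fn; reflexivity].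
    apply is_square_mul; [apply is_square_sc; unfold K; lra | exact He]. }
  rewrite rnorm_scale, Rabs_right in Hle by (unfold K; lra).
  fold m in Hle.
  assert (Hle2 := rnorm_sc_le (K * m - 1)).
  rewrite Rabs_right in Hle2 by (rewrite HKm; nra). lra.
Qed.

(* Because [n a p <= a (1 + (1-a) + ... + (1-a)^(n-1)) = 1 - (1-a)^n <= 1]. *)
Lemma mul_eq0_of_le_pow a p :
  is_square a -> is_square (1 - a)%fn -> is_square p ->
  (forall n, is_square (rpow (1 - a)%fn n - p)%fn) -> (a * p = 0)%fn.
Proof.
  intros Ha Ha1 Hp Hle.
  assert (Hn : forall n, is_square (1 - #(INR n) * (a * p) - rpow (1 - a)%fn n)%fn).
  { induction n as [|n IH].
    - exists 0%fn. simpl. rewrite rsc_0. ring.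
    - replace (1 - #(INR (S n)) * (a * p) - rpow (1 - a)%fn (S n))%fn
        with ((1 - #(INR n) * (a * p) - rpow (1 - a)%fn n)
              + a * (rpow (1 - a)%fn n - p))%fn
        by (rewrite S_INR, rsc_add, rsc_1; simpl; ring).
      apply is_square_add; [exact IH|]. apply is_square_mul; auto. }
  assert (Hb : forall n, INR n * ⟦a * p⟧ <= 1).
  { intros n. assert (H0 := pos_INR n).
    rewrite <- (Rabs_right (INR n)), <- rnorm_scale by lra.
    eapply Rle_trans; [|apply rnorm_1_le].
    replace 1%fn with (#(INR n) * (a * p)
      + ((1 - #(INR n) * (a * p) - rpow (1 - a)%fn n) + rpow (1 - a)%fn n))%fn by ring.
    apply rnorm_le_add.
    - apply is_square_mul; [apply is_square_sc; lra | apply is_square_mul; assumption].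
    - apply is_square_add; [apply Hn | apply is_square_pow; exact Ha1]. }
  apply rnorm_eq0. assert (H0 := rnorm_nonneg B (a * p)%fn).
  destruct (Req_dec (⟦a * p⟧) 0) as [H|H]; [exact H|exfalso].
  destruct (INR_unbounded (/ ⟦a * p⟧)) as [n Hn1].
  specialize (Hb n).
  assert (H1 : / ⟦a * p⟧ * ⟦a * p⟧ = 1) by (apply Rinv_l; exact H).
  nra.
Qed.

(** * The projection onto an annihilator *)

(** Used to see that [1 - (1-a)^m] and [1 - (1-e)^n] have product zero as soon as [a e = 0]. *)
Lemma one_minus_rpow_divisible a n : exists c, (1 - rpow (1 - a)%fn n = a * c)%fn.
Proof.
  induction n as [|n [c Hc]]; [exists 0%fn; simpl; ring|].
  exists (rpow (1 - a)%fn n + c)%fn. simpl.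
  transitivity (a * rpow (1 - a)%fn n + (1 - rpow (1 - a)%fn n))%fn; [ring|].
  rewrite Hc. ring.
Qed.

Lemma scaled_square x : exists s, 0 < s /\
  is_square (#s * (x * x))%fn /\ is_square (1 - #s * (x * x))%fn.
Proof.
  set (t := ⟦x * x⟧). assert (Ht : 0 <= t) by apply rnorm_nonneg.
  exists (/ (1 + t)). assert (Hs : 0 < / (1 + t)) by (apply Rinv_0_lt_compat; lra).
  split; [exact Hs|split].
  - apply is_square_mul; [apply is_square_sc; lra | exists x; reflexivity].
  - apply one_minus_is_square. rewrite rnorm_scale, Rabs_right by lra. fold t.
    apply (Rmult_le_reg_l (1 + t)); [lra|]. rewrite <- Rmult_assoc, Rinv_r by lra. lra.
Qed.

(** The square of [x y] is a multiple of [s x^2 y], and an element with zero square is zero. *)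
Lemma scaled_square_mul_eq0 s x y :
  0 < s -> (#s * (x * x) * y = 0)%fn -> (x * y = 0)%fn.
Proof.
  intros Hs H. apply rmul_self_eq0.
  transitivity (#s * (#(/ s) * (x * x * y * y)))%fn;
    [rewrite rsc_inv_mul by lra; ring|].
  transitivity (#(/ s) * ((#s * (x * x) * y) * y))%fn; [ring | rewrite H; ring].
Qed.

(** Here [x <= y] is read as [y - x] being a square; [cle_iff_is_square] identifies this with the
    spectral order. *)
Definition monotone_sigma_complete_real : Prop :=
  forall u : nat -> B,
    (forall n, is_square (u (S n) - u n)%fn) ->
    (exists K, forall n, ⟦u n⟧ <= K) ->
    exists s, (forall n, is_square (s - u n)%fn) /\
      (forall t, (forall n, is_square (t - u n)%fn) -> is_square (t - s)%fn).

(** The element [p] is the infimum of the powers [(1-a)^n]. Lying below all of them forces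
    [a p = 0]; dually, if [h d = 0] and [e] is a scaled [d^2], then [1 - p] lies below all
    [(1-e)^n], which forces [e (1 - p) = 0]. *)
Lemma annihilator_projection :
  monotone_sigma_complete_real ->
  forall h, exists p, (p * p = p)%fn /\ (h * p = 0)%fn /\
    forall d, (h * d = 0)%fn -> (p * d = d)%fn.
Proof.
  intros Hsup h.
  destruct (scaled_square h) as (k & Hk & Ha & Ha1).
  set (a := (#k * (h * h))%fn) in *.
  destruct (Hsup (fun n => 1 - rpow (1 - a) n)%fn) as (s & Hub & Hlub).
  - intros n. replace (1 - rpow (1 - a) (S n) - (1 - rpow (1 - a) n))%fn
      with (a * rpow (1 - a)%fn n)%fn by (simpl; ring).
    apply is_square_mul; [exact Ha | apply is_square_pow; exact Ha1].
  - exists (⟦1⟧). intros n.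
    replace (⟦1⟧) with (⟦(1 - rpow (1 - a) n) + rpow (1 - a) n⟧) by (f_equal; ring).
    apply rnorm_le_add; [|apply is_square_pow; exact Ha1].
    clear Hsup. induction n as [|n IH]; [exists 0%fn; simpl; ring|].
    replace (1 - rpow (1 - a) (S n))%fn
      with ((1 - rpow (1 - a) n) + a * rpow (1 - a)%fn n)%fn by (simpl; ring).
    apply is_square_add; [exact IH|].
    apply is_square_mul; [exact Ha | apply is_square_pow; exact Ha1].
  - set (p := (1 - s)%fn).
    assert (Hp : is_square p).
    { apply Hlub. intros n. replace (1 - (1 - rpow (1 - a) n))%fn
        with (rpow (1 - a)%fn n) by ring. apply is_square_pow; exact Ha1. }
    assert (Hpow : forall n, is_square (rpow (1 - a)%fn n - p)%fn).
    { intros n. replace (rpow (1 - a) n - p)%fn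
        with (s - (1 - rpow (1 - a) n))%fn by (unfold p; ring). apply Hub. }
    assert (Hap : (a * p = 0)%fn) by (apply mul_eq0_of_le_pow; assumption).
    assert (Hhp : (h * p = 0)%fn) by (apply (scaled_square_mul_eq0 k); assumption).
    assert (Hunit : forall d, (h * d = 0)%fn -> (p * d = d)%fn).
    { intros d Hd. destruct (scaled_square d) as (k' & Hk' & He & He1).
      set (e := (#k' * (d * d))%fn) in *.
      assert (Hae : (a * e = 0)%fn).
      { transitivity (#k * #k' * h * d * (h * d))%fn; [unfold a, e; ring|].
        rewrite Hd. ring. }
      assert (Hep : (e * (1 - p) = 0)%fn).
      { apply mul_eq0_of_le_pow; [exact He|exact He1| |].
        (* The zeroth power is 1, so this says that [1 - p] is a square. *)
        - exact (Hpow 0%nat).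
        - intros n. replace (rpow (1 - e) n - (1 - p))%fn
            with (rpow (1 - e)%fn n - s)%fn by (unfold p; ring).
          apply Hlub. intros m.
          destruct (one_minus_rpow_divisible a m) as [c1 Hc1].
          destruct (one_minus_rpow_divisible e n) as [c2 Hc2].
          (* For [P = (1-a)^m] and [Q = (1-e)^n] one has [Q - (1 - P) = P Q - (1 - P) (1 - Q)]; the
             last product vanishes, leaving the product of squares [P Q]. *)
          assert (H0 : ((1 - rpow (1 - a) m) * (1 - rpow (1 - e) n) = 0)%fn).
          { rewrite Hc1, Hc2. transitivity (a * e * (c1 * c2))%fn; [ring|].
            rewrite Hae. ring. }
          replace (rpow (1 - e) n - (1 - rpow (1 - a) m))%fn
            with (rpow (1 - a) m * rpow (1 - e) n
                  - (1 - rpow (1 - a) m) * (1 - rpow (1 - e) n))%fn by ring.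
          rewrite H0. replace (rpow (1 - a) m * rpow (1 - e) n - 0)%fn
            with (rpow (1 - a) m * rpow (1 - e) n)%fn by ring.
          apply is_square_mul; apply is_square_pow; assumption. }
      apply scaled_square_mul_eq0 in Hep; [|exact Hk'].
      transitivity (d - d * (1 - p))%fn; [ring | rewrite Hep; ring]. }
    (* Since [h p = 0], the unit property applied to [p] itself gives idempotence. *)
    exists p. split; [apply Hunit; exact Hhp | split; assumption].
Qed.

End RealFunctionAlgebraTheory.

(** * Elementary C*-algebra *)

Section CStarBasics.
Variable A : UnitalCStarAlgebra.
Implicit Types a b c x y : A.

Definition commute a b : Prop := mul A a b = mul A b a.

Lemma add_zero_l a : add A (zero A) a = a.
Proof. rewrite add_comm. apply add_zero. Qed.

Lemma add_cancel_l a b c : add A a b = add A a c -> b = c.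
Proof.
  intros H. rewrite <- (add_zero_l b), <- (add_zero_l c), <- (add_opp A a).
  rewrite (add_comm A a), <- !add_assoc, H. reflexivity.
Qed.

Lemma opp_unique a b : add A a b = zero A -> b = opp A a.
Proof. intros H. apply (add_cancel_l a). rewrite H, add_opp. reflexivity. Qed.

Lemma opp_opp a : opp A (opp A a) = a.
Proof. symmetry. apply opp_unique. rewrite add_comm. apply add_opp. Qed.

Lemma sub_eq0 a b : add A a (opp A b) = zero A -> a = b.
Proof.
  intros H. rewrite <- (opp_opp b), (add_comm A) in *.
  apply opp_unique in H. rewrite H, opp_opp. reflexivity.
Qed.

Lemma mul_0_r a : mul A a (zero A) = zero A.
Proof.
  apply (add_cancel_l (mul A a (zero A))).
  rewrite <- mul_addr, !add_zero. reflexivity.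
Qed.

Lemma mul_0_l a : mul A (zero A) a = zero A.
Proof.
  apply (add_cancel_l (mul A (zero A) a)).
  rewrite <- mul_addl, !add_zero. reflexivity.
Qed.

Lemma mul_opp_r a b : mul A a (opp A b) = opp A (mul A a b).
Proof. apply opp_unique. rewrite <- mul_addr, add_opp. apply mul_0_r. Qed.

Lemma mul_opp_l a b : mul A (opp A a) b = opp A (mul A a b).
Proof. apply opp_unique. rewrite <- mul_addl, add_opp. apply mul_0_l. Qed.

Lemma smul_0_l a : smul A C0 a = zero A.
Proof.
  apply (add_cancel_l (smul A C0 a)). rewrite <- smul_addl, add_zero.
  f_equal. unfold Cadd, C0; simpl. f_equal; ring.
Qed.

Lemma smul_0_r l : smul A l (zero A) = zero A.
Proof.
  apply (add_cancel_l (smul A l (zero A))). rewrite <- smul_addr, !add_zero. reflexivity.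
Qed.

Lemma opp_smul a : opp A a = smul A (Cof (-1)) a.
Proof.
  symmetry. apply opp_unique. rewrite <- (smul_one A a) at 1.
  rewrite <- smul_addl, <- (smul_0_l a). f_equal.
  unfold Cadd, Cof, C1, C0; simpl. f_equal; ring.
Qed.

Lemma star_0 : star A (zero A) = zero A.
Proof.
  apply (add_cancel_l (star A (zero A))). rewrite <- star_add, !add_zero. reflexivity.
Qed.

Lemma star_opp a : star A (opp A a) = opp A (star A a).
Proof. apply opp_unique. rewrite <- star_add, add_opp. apply star_0. Qed.

Lemma star_1 : star A (one A) = one A.
Proof.
  rewrite <- (mul_one_l A (star A (one A))), <- (star_star A (one A)) at 1.
  rewrite <- star_mul, mul_one_l. apply star_star.
Qed.

Lemma norm_0 : norm A (zero A) = 0.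
Proof.
  rewrite <- (smul_0_l (zero A)), norm_smul. unfold Cmod, C0; simpl.
  rewrite Rmult_0_l, Rplus_0_r, sqrt_0. ring.
Qed.

Lemma Cmod_Cof s : Cmod (Cof s) = Rabs s.
Proof.
  unfold Cmod, Cof; simpl. rewrite Rmult_0_l, Rplus_0_r. apply sqrt_Rsqr_abs.
Qed.

Lemma norm_opp a : norm A (opp A a) = norm A a.
Proof. rewrite opp_smul, norm_smul, Cmod_Cof, Rabs_left by lra. ring. Qed.

Lemma opp_add a b : opp A (add A a b) = add A (opp A a) (opp A b).
Proof. rewrite !opp_smul. apply smul_addr. Qed.

Lemma norm_sub_sym a b : norm A (add A a (opp A b)) = norm A (add A b (opp A a)).
Proof. rewrite <- norm_opp, opp_add, opp_opp, add_comm. reflexivity. Qed.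

Lemma norm_sub_triangle a b c :
  norm A (add A a (opp A c)) <= norm A (add A a (opp A b)) + norm A (add A b (opp A c)).
Proof.
  replace (add A a (opp A c))
    with (add A (add A a (opp A b)) (add A b (opp A c))); [apply norm_triangle|].
  rewrite <- add_assoc, (add_assoc A (opp A b)), (add_comm A (opp A b)), add_opp.
  rewrite add_zero_l. reflexivity.
Qed.

Lemma norm_star a : norm A (star A a) = norm A a.
Proof.
  assert (H : forall b, norm A b <= norm A (star A b)).
  { intros b. assert (H := norm_submult A (star A b) b).
    rewrite cstar_identity in H.
    assert (H0 := norm_nonneg A b). assert (H1 := norm_nonneg A (star A b)). nra. }
  apply Rle_antisym; [|apply H].
  rewrite <- (star_star A a) at 2. apply H.
Qed.

Lemma norm_small a : (forall eps, 0 < eps -> norm A a <= eps) -> a = zero A.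
Proof.
  intros H. apply norm_eq0. apply Rle_antisym; [|apply norm_nonneg].
  destruct (Rle_or_lt (norm A a) 0) as [Ha|Ha]; [exact Ha|].
  specialize (H (norm A a / 2)). lra.
Qed.

Lemma star_mul_self_eq0 a : mul A (star A a) a = zero A -> a = zero A.
Proof.
  intros H. apply norm_eq0. assert (H1 := cstar_identity A a).
  rewrite H, norm_0 in H1. nra.
Qed.

(** * Commutation, inverses, limits and self-adjointness *)

Lemma commute_sym a b : commute a b -> commute b a.
Proof. unfold commute. congruence. Qed.

Lemma commute_0 a : commute a (zero A).
Proof. unfold commute. rewrite mul_0_r, mul_0_l. reflexivity. Qed.

Lemma commute_1 a : commute a (one A).
Proof. unfold commute. rewrite mul_one_l, mul_one_r. reflexivity. Qed.

Lemma commute_add a b c : commute a b -> commute a c -> commute a (add A b c).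
Proof. unfold commute. intros H1 H2. rewrite mul_addr, mul_addl. congruence. Qed.

Lemma commute_opp a b : commute a b -> commute a (opp A b).
Proof. unfold commute. intros H. rewrite mul_opp_r, mul_opp_l. congruence. Qed.

Lemma commute_smul l a b : commute a b -> commute a (smul A l b).
Proof. unfold commute. intros H. rewrite <- smul_mulr, <- smul_mull. congruence. Qed.

Lemma commute_mul a b c : commute a b -> commute a c -> commute a (mul A b c).
Proof.
  unfold commute. intros H1 H2.
  rewrite mul_assoc, H1, <- mul_assoc, H2, mul_assoc. reflexivity.
Qed.

Lemma commute_star a b : commute a b -> commute (star A a) (star A b).
Proof. unfold commute. intros H. rewrite <- !star_mul. congruence. Qed.

Lemma left_right_inverse a l r :
  mul A l a = one A -> mul A a r = one A -> l = r.
Proof.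
  intros Hl Hr. rewrite <- (mul_one_r A l), <- Hr, mul_assoc, Hl. apply mul_one_l.
Qed.

(** [a y = y b a y = y a b y = y a]. *)
Lemma commute_inverse a b y :
  mul A b y = one A -> mul A y b = one A -> commute a b -> commute a y.
Proof.
  unfold commute. intros H1 H2 H.
  rewrite <- (mul_one_l A (mul A a y)), <- H2, <- mul_assoc, (mul_assoc A b), <- H.
  rewrite <- (mul_assoc A a b y), H1, mul_one_r. reflexivity.
Qed.

Lemma commute_limit a l (u : nat -> A) :
  (forall eps, 0 < eps -> exists N, forall n, (N <= n)%nat ->
     norm A (add A (u n) (opp A l)) < eps) ->
  (forall n, commute a (u n)) -> commute a l.
Proof.
  intros Hl Hu. apply sub_eq0, norm_small. intros eps Heps.
  assert (Ha := norm_nonneg A a).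
  destruct (Hl (eps / (2 * norm A a + 1))) as [N HN].
  { apply Rdiv_lt_0_compat; lra. }
  specialize (HN N (le_n N)). specialize (Hu N).
  eapply Rle_trans; [apply (norm_sub_triangle _ (mul A a (u N)))|].
  unfold commute in Hu.
  rewrite norm_sub_sym, <- mul_opp_r, <- mul_addr, Hu, <- mul_opp_l, <- mul_addl.
  assert (H1 := norm_submult A a (add A (u N) (opp A l))).
  assert (H2 := norm_submult A (add A (u N) (opp A l)) a).
  assert (H3 : eps / (2 * norm A a + 1) * (2 * norm A a + 1) = eps)
    by (field; lra).
  assert (H4 := norm_nonneg A (add A (u N) (opp A l))). nra.
Qed.

Lemma self_adjoint_limit l (u : nat -> A) :
  (forall eps, 0 < eps -> exists N, forall n, (N <= n)%nat ->
     norm A (add A (u n) (opp A l)) < eps) ->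
  (forall n, self_adjoint A (u n)) -> self_adjoint A l.
Proof.
  intros Hl Hu. apply sub_eq0, norm_small. intros eps Heps.
  destruct (Hl (eps / 2)) as [N HN]; [lra|].
  specialize (HN N (le_n N)).
  eapply Rle_trans; [apply (norm_sub_triangle _ (u N))|].
  assert (H := norm_star (add A (u N) (opp A l))).
  rewrite star_add, star_opp, (Hu N), norm_sub_sym in H. lra.
Qed.

Lemma self_adjoint_mul a b :
  self_adjoint A a -> self_adjoint A b -> commute a b -> self_adjoint A (mul A a b).
Proof. unfold self_adjoint, commute. intros Ha Hb H. rewrite star_mul. congruence. Qed.

Lemma self_adjoint_smul s a :
  self_adjoint A a -> self_adjoint A (smul A (Cof s) a).
Proof.
  unfold self_adjoint. intros Ha. rewrite star_smul, Ha. f_equal.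
  unfold Cconj, Cof; simpl. f_equal; ring.
Qed.

Lemma self_adjoint_inverse a y :
  self_adjoint A a -> mul A a y = one A -> mul A y a = one A -> self_adjoint A y.
Proof.
  unfold self_adjoint. intros Ha H1 H2. apply (left_right_inverse a); [|exact H1].
  rewrite <- Ha at 1. rewrite <- star_mul, H1. exact star_1.
Qed.

(** * The C*-identity for [a + i b] *)

Definition add_i a b : A := add A a (smul A (0, 1) b).

Lemma star_add_i a b : self_adjoint A a -> self_adjoint A b ->
  star A (add_i a b) = add_i a (opp A b).
Proof.
  unfold self_adjoint, add_i. intros Ha Hb.
  rewrite star_add, star_smul, Ha, Hb, opp_smul, smul_assoc. do 2 f_equal.
  unfold Cconj, Cmul, Cof; simpl. f_equal; ring.
Qed.

Lemma star_add_i_mul a b : self_adjoint A a -> self_adjoint A b -> commute a b ->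
  mul A (star A (add_i a b)) (add_i a b) = add A (mul A a a) (mul A b b).
Proof.
  intros Ha Hb H. rewrite star_add_i by assumption. unfold add_i.
  rewrite mul_addl, !mul_addr, opp_smul, <- !smul_mull, <- !smul_mulr, <- H.
  rewrite !smul_assoc, <- add_assoc. f_equal.
  rewrite add_assoc, <- smul_addl.
  replace (Cadd _ _) with C0 by (unfold Cadd, Cmul, Cof, C0; simpl; f_equal; ring).
  rewrite smul_0_l, add_zero_l.
  replace (Cmul _ _) with C1 by (unfold Cmul, Cof, C1; simpl; f_equal; ring).
  apply smul_one.
Qed.

(** By the C*-identity the right side is the squared norm of [a + i b]; and [2 a] is the sum of
    [a + i b] and its adjoint, so [a] has norm at most that of [a + i b]. *)
Lemma norm_sum_squares a b : self_adjoint A a -> self_adjoint A b -> commute a b ->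
  norm A a * norm A a <= norm A (add A (mul A a a) (mul A b b)).
Proof.
  intros Ha Hb H. rewrite <- star_add_i_mul, cstar_identity by assumption.
  assert (H0 : norm A a <= norm A (add_i a b)).
  { assert (H1 := norm_triangle A (add_i a b) (star A (add_i a b))).
    rewrite norm_star in H1.
    replace (add A (add_i a b) (star A (add_i a b))) with (smul A (Cof 2) a) in H1.
    - rewrite norm_smul, Cmod_Cof, Rabs_right in H1 by lra. lra.
    - rewrite star_add_i by assumption. unfold add_i.
      rewrite opp_smul, smul_assoc, (add_comm A a (smul A (Cmul _ _) b)).
      rewrite <- add_assoc, (add_assoc A _ _ a), <- smul_addl.
      replace (Cadd (0, 1) _) with C0
        by (unfold Cadd, Cmul, Cof, C0; simpl; f_equal; ring).
      rewrite smul_0_l, add_zero_l. rewrite <- (smul_one A a) at 2 3.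
      rewrite <- smul_addl. f_equal. unfold Cadd, Cof, C1; simpl. f_equal; ring. }
  assert (H1 := norm_nonneg A a). nra.
Qed.

Lemma sig_eq (P : A -> Prop) (x y : {a | P a}) : proj1_sig x = proj1_sig y -> x = y.
Proof.
  destruct x as [x Hx], y as [y Hy]; simpl. intros <-. f_equal. apply proof_irrelevance.
Qed.

(** The adjoint of a right inverse of [star a] is a left inverse of [a]. *)
Lemma invertible_of_right_inverses a r r' :
  mul A a r = one A -> mul A (star A a) r' = one A -> invertible A a.
Proof.
  intros Hr Hr'.
  assert (Hl : mul A (star A r') a = one A).
  { rewrite <- (star_star A a), <- star_mul, Hr'. exact star_1. }
  exists r. split; [exact Hr|]. rewrite <- (left_right_inverse _ _ _ Hl Hr). exact Hl.
Qed.

(** * Maximal commuting sets *)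

Definition pairwise_commuting (S : A -> Prop) : Prop :=
  forall a b, S a -> S b -> commute a b.

(** Zorn's lemma, with the conditions imposed on the union of [S] and [X] instead of requiring [X]
    to contain [S]: the union of the empty chain must qualify as well. *)
Lemma maximal_commuting_set (P S : A -> Prop) :
  (forall a, S a -> P a) -> pairwise_commuting S ->
  exists T : A -> Prop, (forall a, S a -> T a) /\ (forall a, T a -> P a) /\
    pairwise_commuting T /\
    forall b, P b -> (forall a, T a -> commute a b) -> T b.
Proof.
  intros HSP HSc.
  set (good := fun X : A -> Prop =>
    (forall a, S a \/ X a -> P a) /\ pairwise_commuting (fun a => S a \/ X a)).
  destruct (@classical_sets.Zorn_bigcup A good) as (X & [HXP HXc] & Hmax).
  { intros F HF Htot. split.
    - intros a [Ha|[X HX Ha]]; [exact (HSP a Ha)|].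
      apply (proj1 (HF X HX)). right; exact Ha.
    - intros a b [Ha|[X HX Ha]] [Hb|[Y HY Hb]].
      + exact (HSc a b Ha Hb).
      + apply (proj2 (HF Y HY)); [left|right]; assumption.
      + apply (proj2 (HF X HX)); [right|left]; assumption.
      + destruct (Htot X Y HX HY) as [H|H].
        * apply (proj2 (HF Y HY)); right; [apply H|]; assumption.
        * apply (proj2 (HF X HX)); right; [|apply H]; assumption. }
  exists (fun a => S a \/ X a).
  split; [auto|]. split; [exact HXP|]. split; [exact HXc|].
  intros b Hb Hcomm. apply NNPP. intros HnT.
  apply (Hmax (fun a => X a \/ a = b)).
  - split; [intros a Ha; left; exact Ha|].
    intros H. apply HnT. right. apply H. right. reflexivity.
  - assert (Hb' : commute b b) by reflexivity.
    split.
    + intros a [Ha|[Ha| ->]]; auto.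
    + intros a c Ha Hc.
      assert (Ha' : (S a \/ X a) \/ a = b) by tauto.
      assert (Hc' : (S c \/ X c) \/ c = b) by tauto.
      destruct Ha' as [Ha'| ->], Hc' as [Hc'| ->]; auto using commute_sym.
Qed.

(** * The real function algebra of a maximal commuting set of self-adjoint elements *)

Section MaximalCommuting.
Variable T : A -> Prop.
(** Maximality stated as a membership test: each closure property of [T] reduces to self-adjointness
    and commutation with [T]. *)
Hypothesis T_iff : forall a, T a <-> self_adjoint A a /\ forall t, T t -> commute t a.

Lemma T_self_adjoint a : T a -> self_adjoint A a.
Proof. intros Ha. apply T_iff, Ha. Qed.

Lemma T_commute a b : T a -> T b -> commute a b.
Proof. intros Ha Hb. apply T_iff; assumption. Qed.

Lemma T_zero : T (zero A).
Proof. apply T_iff. split; [exact star_0 | intros; apply commute_0]. Qed.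

Lemma T_one : T (one A).
Proof. apply T_iff. split; [exact star_1 | intros; apply commute_1]. Qed.

Lemma T_add a b : T a -> T b -> T (add A a b).
Proof.
  intros Ha Hb. apply T_iff. split.
  - unfold self_adjoint. rewrite star_add, !T_self_adjoint by assumption. reflexivity.
  - intros t Ht. apply commute_add; apply T_commute; assumption.
Qed.

Lemma T_opp a : T a -> T (opp A a).
Proof.
  intros Ha. apply T_iff. split.
  - unfold self_adjoint. rewrite star_opp, T_self_adjoint by assumption. reflexivity.
  - intros t Ht. apply commute_opp, T_commute; assumption.
Qed.

Lemma T_mul a b : T a -> T b -> T (mul A a b).
Proof.
  intros Ha Hb. apply T_iff. split.
  - apply self_adjoint_mul; [apply T_self_adjoint.. | apply T_commute]; assumption.
  - intros t Ht. apply commute_mul; apply T_commute; assumption.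
Qed.

Lemma T_smul s a : T a -> T (smul A (Cof s) a).
Proof.
  intros Ha. apply T_iff. split.
  - apply self_adjoint_smul, T_self_adjoint, Ha.
  - intros t Ht. apply commute_smul, T_commute; assumption.
Qed.

Lemma T_inverse a y : T a -> mul A a y = one A -> mul A y a = one A -> T y.
Proof.
  intros Ha H1 H2. apply T_iff. split.
  - apply (self_adjoint_inverse a); [apply T_self_adjoint|..]; assumption.
  - intros t Ht. apply (commute_inverse t a); [..|apply T_commute]; assumption.
Qed.

(** Left transparent, because later proofs compute the underlying elements of its operations. *)
Definition real_function_algebra : RealFunctionAlgebra.
Proof.
  refine {|
    rcar := {a : A | T a};
    r0 := exist _ _ T_zero;
    r1 := exist _ _ T_one;
    radd u v := exist _ _ (T_add _ _ (proj2_sig u) (proj2_sig v));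
    rmul u v := exist _ _ (T_mul _ _ (proj2_sig u) (proj2_sig v));
    ropp u := exist _ _ (T_opp _ (proj2_sig u));
    rsc s := exist _ _ (T_smul s _ T_one);
    rnorm u := norm A (proj1_sig u)
  |}.
  - split; intros; apply sig_eq; simpl.
    + apply add_zero_l.
    + apply add_comm.
    + apply add_assoc.
    + apply mul_one_l.
    + apply T_commute; apply proj2_sig.
    + apply mul_assoc.
    + apply mul_addl.
    + reflexivity.
    + apply add_opp.
  - apply sig_eq; simpl. apply smul_one.
  - intros s t. apply sig_eq; simpl. rewrite <- smul_addl. f_equal.
    unfold Cadd, Cof; simpl. f_equal; ring.
  - intros s t. apply sig_eq; simpl. rewrite <- smul_mull, mul_one_l, smul_assoc.
    f_equal. unfold Cmul, Cof; simpl. f_equal; ring.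
  - intros x. apply norm_nonneg.
  - intros x H. apply sig_eq; simpl. apply norm_eq0, H.
  - intros x y. apply norm_triangle.
  - intros x y. apply norm_submult.
  - intros s x. simpl. rewrite <- smul_mull, mul_one_l, norm_smul, Cmod_Cof. reflexivity.
  (* For self-adjoint [x] the C*-identity is multiplicativity of the norm on squares. *)
  - intros [x Hx]. simpl. rewrite <- cstar_identity, T_self_adjoint by exact Hx.
    reflexivity.
  - intros [x Hx] [y Hy]. simpl.
    apply norm_sum_squares; [apply T_self_adjoint.. | apply T_commute]; assumption.
  - intros u Hu. destruct (complete A (fun n => proj1_sig (u n)) Hu) as [l Hl].
    assert (HT : T l).
    { apply T_iff. split.
      - apply (self_adjoint_limit _ _ Hl). intros n. apply T_self_adjoint, proj2_sig.
      - intros t Ht. apply (commute_limit _ _ _ Hl). intros n.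
        apply T_commute; [exact Ht | apply proj2_sig]. }
    exists (exist _ l HT). exact Hl.
Defined.

(** * Spectral positivity and squares *)

(** As [-eps] is outside the spectrum, [b + eps] is invertible in [A]; its inverse again lies in
    [T], so the criterion [add_sc_invertible_is_square] applies. *)
Lemma positive_is_square (b : real_function_algebra) :
  positive A (proj1_sig b) -> is_square real_function_algebra b.
Proof.
  intros [_ Hpos]. apply add_sc_invertible_is_square. intros eps Heps.
  assert (Hinv : invertible A
    (sub A (proj1_sig b) (smul A (Cof (- eps)) (one A)))).
  { apply NNPP. intros H. destruct (Hpos _ H) as [_ H1]. simpl in H1. lra. }
  set (c := radd real_function_algebra b (rsc real_function_algebra eps)).
  replace (sub A _ _) with (proj1_sig c) in Hinv.
  2:{ unfold sub. rewrite opp_smul, smul_assoc. simpl. do 2 f_equal.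
      unfold Cmul, Cof; simpl. f_equal; ring. }
  destruct Hinv as (y & Hy1 & Hy2).
  exists (exist _ y (T_inverse _ _ (proj2_sig c) Hy1 Hy2)).
  apply sig_eq. exact Hy1.
Qed.

(* With [c = b - Re l], a right inverse of [b - l = c - i Im l] is
   [(c + i Im l) (c^2 + (Im l)^2)^-1]. *)
Lemma square_minus_nonreal_right_inverse (b : real_function_algebra) (l : Cplx) :
  Cim l <> 0 ->
  exists r, mul A (sub A (proj1_sig b) (smul A l (one A))) r = one A.
Proof.
  intros Hl. destruct l as [s t]; simpl in Hl.
  set (B := real_function_algebra) in *.
  set (c := radd B b (rsc B (- s))).
  destruct (is_square_add_sc_invertible B (rmul B c c) (t * t)) as [y Hy].
  { exists c. reflexivity. }
  { nra. }
  apply (f_equal (@proj1_sig A T)) in Hy. simpl in Hy.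
  set (d := smul A (Cof t) (one A)).
  assert (Hd : T d) by (apply T_smul, T_one).
  exists (mul A (add_i (proj1_sig c) d) (proj1_sig y)).
  rewrite mul_assoc. refine (eq_trans _ Hy). f_equal.

  replace (sub A _ _) with (star A (add_i (proj1_sig c) d)).
  - rewrite star_add_i_mul;
      [|apply T_self_adjoint; first [exact Hd | apply proj2_sig]..
       |apply T_commute; [apply proj2_sig | exact Hd]].
    simpl. f_equal. unfold d. rewrite <- smul_mull, mul_one_l, smul_assoc. f_equal.
    unfold Cmul, Cof; simpl. f_equal; ring.
  - rewrite star_add_i; [|apply T_self_adjoint; first [exact Hd | apply proj2_sig]..].
    unfold add_i, sub, d, c. simpl. rewrite <- add_assoc. f_equal.
    rewrite !opp_smul, !smul_assoc, <- smul_addl. f_equal.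
    unfold Cadd, Cmul, Cof; simpl. f_equal; ring.
Qed.

Lemma is_square_positive (b : real_function_algebra) :
  is_square real_function_algebra b -> positive A (proj1_sig b).
Proof.
  intros Hb. split; [apply T_self_adjoint, proj2_sig|].
  intros l Hl.
  assert (Him : Cim l = 0).
  { apply NNPP. intros H. apply Hl.
    destruct (square_minus_nonreal_right_inverse b l H) as [r Hr].
    (* [b - Cconj l] is the adjoint of [b - l], so right inverses of both give a two-sided
       inverse. *)
    destruct (square_minus_nonreal_right_inverse b (Cconj l)) as [r' Hr'].
    { simpl. lra. }
    apply (invertible_of_right_inverses _ r r' Hr).
    unfold sub. rewrite star_add, star_opp, star_smul, star_1.
    rewrite T_self_adjoint by apply proj2_sig. exact Hr'. }
  split; [exact Him|].
  destruct (Rle_or_lt 0 (Cre l)) as [H|H]; [exact H|]. exfalso. apply Hl.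
  destruct (is_square_add_sc_invertible _ b (- Cre l) Hb) as [y Hy]; [lra|].
  assert (Hy' := Hy). rewrite (Rmul_comm (rring _)) in Hy'.
  apply (f_equal (@proj1_sig A T)) in Hy, Hy'. simpl in Hy, Hy'.
  exists (proj1_sig y).
  replace (sub A _ _)
    with (add A (proj1_sig b) (smul A (Cof (- Cre l)) (one A))); [split; assumption|].
  unfold sub. rewrite opp_smul, smul_assoc. do 2 f_equal.
  destruct l as [s t]; simpl in Him |- *. subst t.
  unfold Cmul, Cof; simpl. f_equal; ring.
Qed.

(** * The commutant of [T] as a masa *)

(** The complexification [T + i T], whose self-adjoint elements are exactly those of [T]. *)
Definition commutant (a : A) : Prop := forall t, T t -> commute t a.

Lemma commutant_star a : commutant a -> commutant (star A a).
Proof.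
  intros Ha t Ht. rewrite <- (T_self_adjoint t Ht). apply commute_star, Ha, Ht.
Qed.

Definition real_part a : A := smul A (Cof (/ 2)) (add A a (star A a)).
Definition imaginary_part a : A :=
  smul A (0, - / 2) (add A a (opp A (star A a))).

Lemma real_imaginary_decomposition a :
  a = add_i (real_part a) (imaginary_part a).
Proof.
  unfold add_i, real_part, imaginary_part.
  set (Y := smul A (Cof (/ 2)) (star A a)).
  replace (smul A (0, 1) _) with (add A (opp A Y) (smul A (Cof (/ 2)) a)).
  - rewrite smul_addr. fold Y.
    rewrite <- add_assoc, (add_assoc A Y), add_opp, add_zero_l, <- smul_addl.
    rewrite <- (smul_one A a) at 1. f_equal.
    unfold Cadd, Cof, C1; simpl. f_equal; field.
  - unfold Y. rewrite add_comm, !opp_smul, !smul_addr, !smul_assoc.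
    do 2 f_equal; unfold Cmul, Cof; simpl; f_equal; ring.
Qed.

Lemma T_real_part a : commutant a -> T (real_part a).
Proof.
  intros Ha. apply T_iff. split.
  - apply self_adjoint_smul. unfold self_adjoint.
    rewrite star_add, star_star. apply add_comm.
  - intros t Ht. apply commute_smul, commute_add; [|apply commutant_star]; auto.
Qed.

Lemma T_imaginary_part a : commutant a -> T (imaginary_part a).
Proof.
  intros Ha. apply T_iff. split.
  - unfold self_adjoint, imaginary_part.
    replace (star A (smul A _ _))
      with (smul A (Cconj (0, - / 2)) (opp A (add A a (opp A (star A a))))).
    + rewrite opp_smul, smul_assoc. f_equal.
      unfold Cconj, Cmul, Cof; simpl. f_equal; ring.
    + rewrite star_smul, star_add, star_opp, star_star, opp_add, opp_opp, add_comm.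
      reflexivity.
  - intros t Ht. apply commute_smul, commute_add; [|apply commute_opp, commutant_star]; auto.
Qed.

(** Abelian because real and imaginary parts lie in [T]; maximal because an abelian [N] containing
    the commutant contains [T], hence commutes with it. *)
Lemma commutant_masa : masa A commutant.
Proof.
  split; [split; [repeat split|]|].
  - intros t _. apply commute_0.
  - intros a b Ha Hb t Ht. apply commute_add; auto.
  - intros l a Ha t Ht. apply commute_smul; auto.
  - intros a b Ha Hb t Ht. apply commute_mul; auto.
  - exact commutant_star.
  - intros a b Ha Hb. change (commute a b).
    rewrite (real_imaginary_decomposition b).
    apply commute_add; [|apply commute_smul]; apply commute_sym, Ha;
      [apply T_real_part | apply T_imaginary_part]; exact Hb.
  - intros N [_ HN] HMN a Ha t Ht. apply HN; [|exact Ha].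
    apply HMN. intros s Hs. apply T_commute; assumption.
Qed.

Lemma cle_iff_is_square (x y : real_function_algebra) :
  cle A (proj1_sig x) (proj1_sig y) <->
  is_square real_function_algebra
    (radd real_function_algebra y (ropp real_function_algebra x)).
Proof.
  split; intros H; [apply positive_is_square | apply is_square_positive in H]; exact H.
Qed.

Lemma monotone_sigma_complete_commutant :
  monotone_sigma_complete_sub A commutant ->
  monotone_sigma_complete_real real_function_algebra.
Proof.
  intros H u Hinc Hbound.
  assert (HTc : forall a, T a -> commutant a) by (intros a Ha t Ht; apply T_commute; assumption).
  destruct (H (fun n => proj1_sig (u n))) as (s & Hs & Hsa & Hub & Hlub).
  - intros n. split; [apply HTc | apply T_self_adjoint]; apply proj2_sig.
  - intros n. apply cle_iff_is_square, Hinc.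
  - exact Hbound.
  - assert (HT : T s) by (apply T_iff; split; assumption).
    exists (exist _ s HT). split.
    + intros n. apply cle_iff_is_square, Hub.
    + intros t Ht. apply cle_iff_is_square. apply Hlub.
      * apply HTc, proj2_sig.
      * apply T_self_adjoint, proj2_sig.
      * intros n. apply cle_iff_is_square, Ht.
Qed.

End MaximalCommuting.

End CStarBasics.

(** * The right annihilator of an element *)

Theorem theorem2p5 (A : UnitalCStarAlgebra) :
  (forall M : A -> Prop, masa A M -> monotone_sigma_complete_sub A M) ->
  forall x : A, exists f : A, is_projection A f /\
    (forall z : A, mul A x z = zero A <-> exists y : A, z = mul A f y).
Proof.
  intros Hmasa x. set (h := mul A (star A x) x).
  assert (Hh : self_adjoint A h).
  { unfold self_adjoint, h. rewrite star_mul, star_star. reflexivity. }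
  destruct (maximal_commuting_set A
              (fun z => self_adjoint A z /\ mul A h z = zero A) (fun _ => False))
    as (D & _ & HDP & HDc & HDmax); [tauto | intros a b [] |].
  (* Taking adjoints in [h d = 0]; thus [D] commutes with [h], and both fit into one maximal
     commuting set [T]. *)
  assert (HhD : forall d, D d -> mul A d h = zero A).
  { intros d Hd. destruct (HDP d Hd) as [H1 H2].
    rewrite <- H1, <- Hh, <- star_mul, H2. apply star_0. }
  destruct (maximal_commuting_set A (self_adjoint A) (fun a => D a \/ a = h))
    as (T & HST & HTsa & HTc & HTmax).
  { intros a [Ha| ->]; [apply HDP, Ha | exact Hh]. }
  { intros a b [Ha| ->] [Hb| ->].
    - apply HDc; assumption.
    - unfold commute. rewrite HhD by exact Ha. symmetry. apply HDP, Ha.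
    - unfold commute. rewrite HhD by exact Hb. apply HDP, Hb.
    - reflexivity. }
  assert (HT : forall a, T a <-> self_adjoint A a /\ forall t, T t -> commute A t a).
  { intros a. split; [|intros []; auto]. intros Ha. split; [auto|].
    intros t Ht. apply HTc; assumption. }
  assert (Hsup := monotone_sigma_complete_commutant A T HT
                    (Hmasa _ (commutant_masa A T HT))).
  destruct (annihilator_projection _ Hsup (exist _ h (HST h (or_intror eq_refl))))
    as ([p Hp] & Hpp & Hhp & Hunit).
  apply (f_equal (@proj1_sig A T)) in Hpp, Hhp. simpl in Hpp, Hhp.
  assert (Hpd : forall d, D d -> mul A p d = d).
  { intros d Hd. destruct (HDP d Hd) as [_ Hd0].
    assert (H := Hunit (exist _ d (HST d (or_introl Hd)))).
    apply (f_equal (@proj1_sig A T)) in H; [exact H|].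
    apply sig_eq. exact Hd0. }
  assert (Hpsa : star A p = p) by (apply HTsa, Hp).
  exists p. split; [split; assumption|]. intros z. split.
  - intros Hz. exists z. symmetry.
    (* [p] annihilates the element [w = g g*] of the annihilator of [h]; as [w]
       then commutes with [D] (of which [p] is a unit), it lies in [D]. *)
    set (g := add A z (opp A (mul A p z))).
    set (w := mul A g (star A g)).
    assert (Hpg : mul A p g = zero A).
    { unfold g. rewrite mul_addr, mul_opp_r, mul_assoc, Hpp. apply add_opp. }
    assert (Hhg : mul A h g = zero A).
    { unfold g. rewrite mul_addr, mul_opp_r, mul_assoc, Hhp, mul_0_l.
      rewrite opp_smul, smul_0_r, add_zero.
      unfold h. rewrite <- mul_assoc, Hz. apply mul_0_r. }
    (* The adjoint of [d = p d] is [d = d p], so [d g = d p g = 0]. *)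
    assert (Hdg : forall d, D d -> mul A d g = zero A).
    { intros d Hd. rewrite <- (proj1 (HDP d Hd)), <- (Hpd d Hd), star_mul, Hpsa.
      rewrite <- mul_assoc, Hpg. apply mul_0_r. }
    assert (Hwsa : star A w = w).
    { unfold w. rewrite star_mul, star_star. reflexivity. }
    assert (Hw : D w).
    { apply HDmax.
      - split; [exact Hwsa|]. unfold w. rewrite mul_assoc, Hhg. apply mul_0_l.
      - intros d Hd.
        assert (H : mul A d w = zero A).
        { unfold w. rewrite mul_assoc, Hdg by exact Hd. apply mul_0_l. }
        unfold commute. rewrite H. symmetry.
        rewrite <- Hwsa, <- (proj1 (HDP d Hd)), <- star_mul, H. apply star_0. }
    assert (Hw0 : w = zero A).
    { rewrite <- (Hpd w Hw). unfold w. rewrite mul_assoc, Hpg. apply mul_0_l. }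
    (* [w] is the product of the adjoint of [star g] with [star g], so the C*-identity applies to
       [star g]. *)
    assert (Hg0 : star A g = zero A).
    { apply star_mul_self_eq0. rewrite star_star. exact Hw0. }
    symmetry. apply sub_eq0. fold g. rewrite <- (star_star A g), Hg0. apply star_0.
  - intros [y ->]. rewrite mul_assoc.
    (* The adjoint of [x p] times [x p] is [p h p], which vanishes because [h p = 0]. *)
    assert (H : mul A x p = zero A).
    { apply star_mul_self_eq0. rewrite star_mul, <- mul_assoc, (mul_assoc A _ x).
      fold h. rewrite Hhp. apply mul_0_r. }
    rewrite H. apply mul_0_l.
Qed.
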